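(* Let $d$ be a real number with $1 \le d < \sqrt{3}$, and let $\mathbf{D} \in \mathcal{F}(d)$ be an arbitrary disk-polygon with center parameter $d$ in the Euclidean plane $\mathbb{E}^2$. Then the inradius of $\mathbf{D}$ is at least as large as the inradius of $\Delta(d)$, i.e. $$r(\mathbf{D}) \ge r(\Delta(d)).$$
   Context: A disk-polygon is an intersection, with non-empty interior, of finitely many closed circular disks of unit radius in the Euclidean plane $\mathbb{E}^2$. Whenever a disk-polygon is considered, the disks generating it (its generating disks) are assumed to be all needed: each of them contributes to the boundary of the disk-polygon through a circular arc (called a side), and consecutive sides meet in the vertices of the disk-polygon. For $0<d<\sqrt{3}$, a disk-polygon $\mathbf{D}$ is called a disk-polygon with center parameter $d$ if the distance between any two centers of the generating disks of $\mathbf{D}$ is at most $d$. $\mathcal{F}(d)$ denotes the family of all disk-polygons with center parameter $d$. For $1\le d<\sqrt{3}$, $\Delta(d)$ denotes the regular disk-triangle whose three generating unit disks are centered at the vertices of a regular (equilateral) triangle of side length $d$, i.e. the intersection of these three closed unit disks (determined up to congruence). A convex domain is a compact convex set with non-empty interior in $\mathbb{E}^2$. The inradius $r(\mathbf{C})$ of a convex domain $\mathbf{C}$ is the radius of the largest circular disk lying in $\mathbf{C}$. *)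

(* Defs.v *)
From HB Require Import structures.
From mathcomp Require Import all_boot all_order all_algebra.
From mathcomp Require Import all_classical all_reals all_analysis.

Set Implicit Arguments.
Unset Strict Implicit.
Unset Printing Implicit Defensive.

Import Order.TTheory GRing.Theory Num.Theory.
Import numFieldNormedType.Exports.

Local Open Scope classical_set_scope.
Local Open Scope ring_scope.

(* The norm that the library puts on R * R is the sup norm, hence the explicit
   Euclidean distance below. Interior and closure are those of the product
   topology, which is the Euclidean topology. *)
Notation plane R := (R * R)%type.

Section DiskPolygons.
Variable R : realType.
Implicit Types (p q c x : plane R) (r d : R) (A C D : set (plane R)).

Definition edist p q : R :=
  Num.sqrt ((p.1 - q.1) ^+ 2 + (p.2 - q.2) ^+ 2).

Definition cdisk c r : set (plane R) := [set x | edist c x <= r].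

Definition ucircle c : set (plane R) := [set x | edist c x = 1].

Definition bdry A : set (plane R) := closure A `\` A°.

(* Nondegenerate arc of the unit circle around c. The whole circle is allowed
   (b = a + 2 pi), as it is the only side of a disk-polygon with one
   generating disk. *)
Definition is_unit_arc c A : Prop :=
  exists a b : R, [/\ a < b, b <= a + 2 * pi &
    A = [set (c.1 + cos t, c.2 + sin t) | t in `[a, b]]].

Definition unit_disk_inter (cs : seq (plane R)) : set (plane R) :=
  \bigcap_(c in [set` cs]) cdisk c 1.

Definition side D c : set (plane R) := bdry D `&` ucircle c.

(* D is a disk-polygon and cs lists, without repetition, the centers of its
   generating disks, all of which are needed: each contributes a side. *)
Definition is_disk_polygon (cs : seq (plane R)) D : Prop :=
  [/\ cs != [::], uniq cs, D = unit_disk_inter cs, D° !=set0 &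
      forall c, c \in cs -> is_unit_arc c (side D c)].

(* F(d) *)
Definition center_param_family d : set (set (plane R)) :=
  [set D | exists2 cs, is_disk_polygon cs D &
           forall p q, p \in cs -> q \in cs -> edist p q <= d].

(* T is a copy of Delta(d), which is determined only up to congruence. *)
Definition is_regular_disk_triangle d (T : set (plane R)) : Prop :=
  exists p1 p2 p3 : plane R,
    [/\ edist p1 p2 = d, edist p2 p3 = d, edist p3 p1 = d &
        T = unit_disk_inter [:: p1; p2; p3]].

Definition disk_radii C : set R :=
  [set r | 0 < r /\ exists c, cdisk c r `<=` C].

(* For a convex domain the supremum is attained; inradius_largest relates it to
   the radius of the largest disk. *)
Definition inradius C : R := sup (disk_radii C).

Lemma inradius_largest C r :
  disk_radii C r -> ubound (disk_radii C) r -> inradius C = r.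
Proof.
move=> Cr ubr; apply/eqP; rewrite eq_le; apply/andP; split.
  by apply: ge_sup => //; exists r.
by apply: ub_le_sup => //; exists r.
Qed.

End DiskPolygons.

(* Main.v *)
(* A disk of radius r about x lies in the unit disk about c iff |c - x| + r <= 1,
   so the inradius of an intersection of unit disks is 1 minus the radius of the
   smallest disk enclosing their centers. By Jung's theorem centers at mutual
   distance at most d lie in a disk of radius d / sqrt 3, and for an equilateral
   triangle of side d no smaller disk will do.
   Jung's theorem: let x be the center of the smallest enclosing disk and look
   at the centers on its boundary. If two of them are seen from x at an angle of
   at least 120 degrees, their distance gives the bound. Otherwise let v, w be
   the pair (relative to x) with the largest angle; all the others then lie in
   the open half plane of v + w, and moving x slightly in that direction shrinks
   the enclosing disk, a contradiction. *)

Require Import Defs.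
From HB Require Import structures.
From mathcomp Require Import all_boot all_order all_algebra.
From mathcomp Require Import all_classical all_reals all_analysis.
From mathcomp Require Import ring lra.

Set Implicit Arguments.
Unset Strict Implicit.
Unset Printing Implicit Defensive.

Import Order.TTheory GRing.Theory Num.Theory.
Import numFieldNormedType.Exports.

Local Open Scope classical_set_scope.
Local Open Scope ring_scope.

Lemma seq_argmin (T : eqType) (R : realDomainType) (f : T -> R) (s : seq T) :
  s != [::] -> exists2 x, x \in s & forall y, y \in s -> f x <= f y.
Proof.
elim: s => // a [|b s] IH _.
  by exists a => [|y]; rewrite inE // => /eqP ->.
have [//|x xs xmin] := IH.
have [fax|fxa] := leP (f a) (f x).
  exists a => [|y]; rewrite inE ?eqxx // => /predU1P[->//|/xmin].
  exact: le_trans.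
exists x => [|y]; rewrite inE ?xs ?orbT // => /predU1P[->|/xmin //].
exact: ltW.
Qed.

Section Jung.
(* The unqualified edist is MathComp-Analysis's extended distance. *)
Local Notation edist := Defs.edist.
Variable R : realType.
Implicit Types (p q u v x : plane R) (r s : R).

(** * Inner products and angles in the plane *)

Definition dotp u v : R := u.1 * v.1 + u.2 * v.2.

Definition sqdist p q : R := dotp (p - q) (p - q).

Lemma sqdist_ge0 p q : 0 <= sqdist p q.
Proof. by rewrite addr_ge0 // -expr2 sqr_ge0. Qed.

Lemma edist_le p q r : 0 <= r -> (edist p q <= r) = (sqdist p q <= r ^+ 2).
Proof.
move=> r0; rewrite /edist /sqdist /dotp -!expr2 /=.
by rewrite -{1}(ger0_norm r0) -sqrtr_sqr ler_sqrt // sqr_ge0.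
Qed.

(** Three vectors in the plane are linearly dependent, so their Gram determinant vanishes; terms of
    opposite sign stand on opposite sides. *)
Lemma gram_det3 u v w :
  dotp u u * dotp v v * dotp w w + 2 * dotp u v * dotp v w * dotp w u
  = dotp u u * dotp v w ^+ 2 + dotp v v * dotp w u ^+ 2
    + dotp w w * dotp u v ^+ 2.
Proof. by rewrite /dotp; ring. Qed.

(* The gap between the two sides is the Gram determinant of three vectors of
   squared norm r with inner products m, a, b. *)
Lemma narrow_gram_gt0 r (a b m : R) : 0 < r -> - r < 2 * m -> m <= a -> m <= b ->
  a + b <= 0 ->
  r * b ^+ 2 + r * a ^+ 2 + r * m ^+ 2 < r * r * r + 2 * m * a * b.
Proof.
move=> r0 m1 ma mb ab.
have key : 0 < (r + m) * (r - m) * r - r * (a + b) ^+ 2 + 2 * (r + m) * (a * b).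
  (* [2 * a + r] and [2 * b + r] are positive, so their product bounds [a * b] below in terms of
     [a + b]. *)
  have pab : - (r * (2 * (a + b) + r)) < 4 * (a * b).
    have : 0 < (2 * a + r) * (2 * b + r) by apply: mulr_gt0; lra.
    lra.
  have rm : 0 < r + m by lra.
  have : 0 < (r + m) * (4 * (a * b) + r * (2 * (a + b) + r)).
    by apply: mulr_gt0; lra.
  (* Inserting that bound into [key] leaves [r] times this quadratic in [a + b], a nonnegative
     combination of the three products below. The limiting case [2 * m = a + b = - r] is three
     vectors at 120 degrees. *)
  have h : 0 <= (r + m) * (r - m) - (a + b) ^+ 2 - (r + m) * (a + b + r / 2).
    have h1 : 0 <= (2 * m + r) * (a + b - 2 * m) by apply: mulr_ge0; lra.
    have h2 : 0 <= (2 * m + r) * - (a + b) by apply: mulr_ge0; lra.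
    have h3 : 0 <= (r + (a + b)) * (r - 2 * (a + b)) by apply: mulr_ge0; lra.
    lra.
  have := mulr_ge0 (ltW r0) h.
  lra.
lra.
Qed.

(** If the largest angle is below 120 degrees, a vector outside the open half plane of [v + w] would
    make the Gram determinant positive, which is impossible in the plane. *)
Lemma wide_pair_or_half_plane r (V : seq (plane R)) : 0 < r ->
    (forall v, v \in V -> dotp v v = r) ->
  (exists v w, [/\ v \in V, w \in V & 2 * dotp v w <= - r]) \/
  (exists u, forall v, v \in V -> 0 < dotp u v).
Proof.
move=> r0 Vr.
have [->|V0] := eqVneq V [::]; first by right; exists 0.
(* Pairs with equal entries are included, so a single vector is no special case. *)
have [|vw /allpairsP[[v w] /= [vV wV ->]] vw_min] :=
  @seq_argmin _ _ (fun vw => dotp vw.1 vw.2) [seq (v, w) | v <- V, w <- V].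
  by case: V V0 {Vr}.
have [wide|narrow] := leP (2 * dotp v w) (- r); first by left; exists v, w.
right; exists (v + w) => z zV.
have vwE : dotp (v + w) z = dotp w z + dotp z v by rewrite /dotp /=; ring.
rewrite vwE ltNge; apply/negP => le0.
have zw := vw_min (w, z) (allpairs_f _ wV zV).
have zv := vw_min (z, v) (allpairs_f _ zV vV).
have := narrow_gram_gt0 r0 narrow zw zv le0.
by have := gram_det3 v w z; rewrite !Vr //; lra.
Qed.

(** * Existence of a smallest enclosing disk *)

Definition enclosing_sqradius (cs : seq (plane R)) x : R :=
  \big[Num.max/0]_(c <- cs) sqdist c x.

Lemma sqdist_le_enclosing cs x c :
  c \in cs -> sqdist c x <= enclosing_sqradius cs x.
Proof. by move=> ccs; exact: (le_bigmax_seq 0 _ xpredT (sqdist^~ x) ccs). Qed.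

Lemma enclosing_lt cs x r : 0 < r -> (forall c, c \in cs -> sqdist c x < r) ->
  enclosing_sqradius cs x < r.
Proof.
by move=> r0 cr; rewrite /enclosing_sqradius big_seq; apply: bigmax_lt.
Qed.

Lemma continuous_sqdist c : continuous (sqdist c : plane R -> R).
Proof.
move=> x; rewrite /sqdist /dotp /=.
have c1 : (c.1 - y.1) @[y --> x] --> c.1 - x.1.
  by apply: cvgB; [exact: cvg_cst|exact: cvg_fst].
have c2 : (c.2 - y.2) @[y --> x] --> c.2 - x.2.
  by apply: cvgB; [exact: cvg_cst|exact: cvg_snd].
by apply: cvgD; apply: cvgM.
Qed.

Lemma continuous_enclosing cs :
  continuous (enclosing_sqradius cs : plane R -> R).
Proof.
elim: cs => [|c cs IH] x.
  rewrite (_ : enclosing_sqradius [::] = cst 0); first exact: cvg_cst.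
  by apply/funext => y; rewrite /enclosing_sqradius big_nil.
rewrite (_ : enclosing_sqradius (c :: cs) =
             sqdist c \max enclosing_sqradius cs).
  by apply: continuous_max; [exact: continuous_sqdist|exact: IH].
by apply/funext => y; rewrite /enclosing_sqradius big_cons.
Qed.

(** Compactness gives a minimum on a square around [c]; outside it the squared distance to [c] alone
    already reaches the value at [c]. *)
Lemma enclosing_has_min c cs : exists x, forall y,
  enclosing_sqradius (c :: cs) x <= enclosing_sqradius (c :: cs) y.
Proof.
set f := enclosing_sqradius _.
have fc : 0 <= f c.
  by apply: le_trans (sqdist_le_enclosing c (mem_head c cs)); exact: sqdist_ge0.
(* [1 + f c] dominates the square root of [f c]. *)
pose M := 1 + f c.
pose A := (`[c.1 - M, c.1 + M] `*` `[c.2 - M, c.2 + M])%classic : set (plane R).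
have cA : A c by split; rewrite /= in_itv /= /M; apply/andP; split; lra.
have [||x _ xmin] := @compact_EVT_min (plane R) R f A (ex_intro _ c cA).
- by apply: compact_setX; exact: segment_compact.
- by apply: continuous_subspaceT; exact: continuous_enclosing.
exists x => y; have [yA|yA] := pselect (A y); first by apply: xmin; rewrite inE.
apply: (@le_trans _ _ (f c)); first by apply: xmin; rewrite inE.
apply: le_trans (sqdist_le_enclosing y (mem_head c cs)).
have [//|lt] := leP (f c) (sqdist c y).
exfalso; apply: yA.
have far (t : R) : t ^+ 2 < f c -> - M <= t <= M.
  rewrite -ler_norml -ler_sqr ?nnegrE ?normr_ge0 //; last by rewrite /M; lra.
  by rewrite real_normK ?num_real // /M; nra.
have sq1 := sqr_ge0 (c.1 - y.1); have sq2 := sqr_ge0 (c.2 - y.2).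
have sE : sqdist c y = (c.1 - y.1) ^+ 2 + (c.2 - y.2) ^+ 2 by [].
have /andP[a1 a2] : - M <= c.1 - y.1 <= M by apply: far; lra.
have /andP[b1 b2] : - M <= c.2 - y.2 <= M by apply: far; lra.
by split; rewrite /= in_itv /=; apply/andP; split; lra.
Qed.

(** Vectors of squared norm below [r] have room for a small shift; those of squared norm [r] shrink
    to first order when moved against [u]. Finitely many vectors admit a common step size. *)
Lemma shift_decreases_sqdist r (V : seq (plane R)) u :
    (forall v, v \in V -> dotp v v < r \/ dotp v v = r /\ 0 < dotp u v) ->
  exists2 e, 0 < e & forall t v, 0 < t -> t <= e -> v \in V ->
    dotp (v - (t * u.1, t * u.2)) (v - (t * u.1, t * u.2)) < r.
Proof.
have dE t v : dotp (v - (t * u.1, t * u.2)) (v - (t * u.1, t * u.2)) =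
    dotp v v - t * (2 * dotp u v - t * dotp u u).
  by rewrite /dotp /=; ring.
have u0 : 0 <= dotp u u by rewrite addr_ge0 // -expr2 sqr_ge0.
elim: V => [|v V IH] hV; first by exists 1.
have [w wV|e e0 he] := IH; first by apply: hV; rewrite inE wV orbT.
suff [e' e'0 he'] : exists2 e', 0 < e' & forall t, 0 < t -> t <= e' ->
    dotp v v - t * (2 * dotp u v - t * dotp u u) < r.
  exists (Num.min e e') => [|t w t0]; first by rewrite lt_min e0.
  rewrite le_min => /andP[te te'] /predU1P[->|wV]; last exact: he.
  by rewrite dE; exact: he'.
have [vr|[vr uv]] := hV v (mem_head _ _).
  (* For [t <= 1] the squared norm grows by at most [t * K]; the factor 2 in the step size uses up
     only half of the gap to [r]. *)
  pose K := 1 + 2 * `|dotp u v| + dotp u u.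
  have K0 : 0 < K by rewrite /K; have := normr_ge0 (dotp u v); lra.
  exists (Num.min 1 ((r - dotp v v) / (2 * K))).
    by rewrite lt_min ltr01 divr_gt0 //; lra.
  move=> t t0; rewrite le_min => /andP[t1].
  rewrite ler_pdivlMr; last by lra.
  have := ler_norm (- dotp u v); rewrite normrN => h.
  have h1 : 0 <= t * (`|dotp u v| + dotp u v) by apply: mulr_ge0; lra.
  have h2 : 0 <= t * ((1 - t) * dotp u u).
    by rewrite !mulr_ge0 // ?subr_ge0 // ltW.
  by rewrite /K => h3; lra.
exists (dotp u v / (1 + dotp u u)); first by rewrite divr_gt0 //; lra.
move=> t t0; rewrite ler_pdivlMr => [h|]; last by lra.
suff : 0 < t * (2 * dotp u v - t * dotp u u) by lra.
by apply: mulr_gt0 => //; lra.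
Qed.

(** * Jung's theorem in the plane *)

Theorem jung (cs : seq (plane R)) d : 0 <= d ->
    (forall p q, p \in cs -> q \in cs -> edist p q <= d) ->
  exists x, forall c, c \in cs -> edist c x <= d / Num.sqrt 3.
Proof.
case: cs => [|c0 cs] d0 hd; first by exists 0.
have [x xmin] := enclosing_has_min c0 cs.
set r := enclosing_sqradius (c0 :: cs) x in xmin.
have le_r c : c \in c0 :: cs -> sqdist c x <= r by exact: sqdist_le_enclosing.
suff rd : r <= d ^+ 2 / 3.
  exists x => c /le_r cr; rewrite edist_le ?divr_ge0 ?sqrtr_ge0 //.
  by rewrite expr_div_n sqr_sqrtr //; apply: le_trans rd.
have [r0|r0] := leP r 0.
  by apply: le_trans r0 _; rewrite divr_ge0 ?sqr_ge0.
pose V := [seq c - x | c <- c0 :: cs].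
pose W := [seq v <- V | dotp v v == r].
have WV v : v \in W -> exists2 c, c \in c0 :: cs & v = c - x.
  by rewrite mem_filter => /andP[_ /mapP].
have [v|[v [w [vW wW vw]]]|[u hu]] := @wide_pair_or_half_plane r W r0.
- by rewrite mem_filter => /andP[/eqP].
(* By the law of cosines, an angle of at least 120 degrees makes the squared distance of [p] and [q]
   at least [3 * r]. *)
- have [[p pcs vE] [q qcs wE]] := (WV _ vW, WV _ wW).
  have := hd _ _ pcs qcs; rewrite edist_le //.
  have -> : sqdist p q = dotp v v + dotp w w - 2 * dotp v w.
    by rewrite vE wE /sqdist /dotp /=; ring.
  move: vW wW; rewrite !mem_filter => /andP[/eqP -> _] /andP[/eqP -> _] ?.
  by rewrite ler_pdivlMr //; lra.
have [v vV|e e0 he] := @shift_decreases_sqdist r V u.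
  have [vr|ne] := eqVneq (dotp v v) r.
    by right; split=> //; apply: hu; rewrite mem_filter vr eqxx.
  left; rewrite lt_neqAle ne /=.
  by have /mapP[c ccs ->] := vV; exact: le_r.
have := xmin (x + (e * u.1, e * u.2)); rewrite leNgt => /negP[].
apply: enclosing_lt => // c ccs.
rewrite /sqdist opprD addrA; apply: he => //.
by apply/mapP; exists c.
Qed.

(** By Leibniz's identity the sum is least at the centroid, where it equals a third of the sum of
    the squared sides. *)
Lemma sqdist_sum_equilateral_ge (p1 p2 p3 x : plane R) s :
    sqdist p1 p2 = s -> sqdist p2 p3 = s -> sqdist p3 p1 = s ->
  s <= sqdist p1 x + sqdist p2 x + sqdist p3 x.
Proof.
move=> s1 s2 s3.
have : sqdist p1 x + sqdist p2 x + sqdist p3 x =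
    (sqdist p1 p2 + sqdist p2 p3 + sqdist p3 p1) / 3 +
    ((p1.1 + p2.1 + p3.1 - 3 * x.1) ^+ 2
     + (p1.2 + p2.2 + p3.2 - 3 * x.2) ^+ 2) / 3.
  by rewrite /sqdist /dotp /=; field.
have := sqr_ge0 (p1.1 + p2.1 + p3.1 - 3 * x.1).
have := sqr_ge0 (p1.2 + p2.2 + p3.2 - 3 * x.2).
lra.
Qed.

(** * Euclidean distance and inclusion of disks *)

Lemma edist_sqdist p q : edist p q = Num.sqrt (sqdist p q).
Proof. by []. Qed.

Lemma edist_ge0 p q : 0 <= edist p q.
Proof. exact: sqrtr_ge0. Qed.

Lemma sqr_edist p q : edist p q ^+ 2 = sqdist p q.
Proof. by rewrite edist_sqdist sqr_sqrtr // sqdist_ge0. Qed.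

Lemma edistC p q : edist p q = edist q p.
Proof. by rewrite !edist_sqdist /sqdist /dotp /=; congr Num.sqrt; ring. Qed.

Lemma edist_triangle p q x : edist p q <= edist p x + edist x q.
Proof.
rewrite edist_le ?addr_ge0 ?edist_ge0 // sqrrD !sqr_edist.
have -> : sqdist p q = sqdist p x + sqdist x q + 2 * dotp (p - x) (x - q).
  by rewrite /sqdist /dotp /=; ring.
suff : dotp (p - x) (x - q) <= edist p x * edist x q by lra.
apply: le_trans (ler_norm _) _.
rewrite -ler_sqr ?nnegrE ?mulr_ge0 ?edist_ge0 // exprMn !sqr_edist.
rewrite real_normK ?num_real // -subr_ge0 /sqdist.
set u := p - x; set v := x - q.
(* Lagrange's identity, which gives the Cauchy-Schwarz inequality. *)
have -> : dotp u u * dotp v v - dotp u v ^+ 2 = (u.1 * v.2 - u.2 * v.1) ^+ 2.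
  by rewrite /dotp; ring.
exact: sqr_ge0.
Qed.

Lemma cdisk_subset x c r s : 0 <= r ->
  cdisk x r `<=` cdisk c s <-> edist c x + r <= s.
Proof.
move=> r0; split=> [sub|le y]; last first.
  rewrite /cdisk /= => xy; apply: le_trans le.
  by apply: le_trans (edist_triangle c y x) _; rewrite lerD2l.
set e := edist c x.
have e0 : 0 <= e by exact: edist_ge0.
(* [u] is the unit vector from [c] towards [x], arbitrary if they coincide; [x + r u] is then a
   point of the disk farthest from [c]. *)
have [u [u1 eu1 eu2]] :
    exists u, [/\ dotp u u = 1, x.1 - c.1 = e * u.1 & x.2 - c.2 = e * u.2].
  have esq : e ^+ 2 = (c.1 - x.1) ^+ 2 + (c.2 - x.2) ^+ 2 by rewrite sqr_edist.
  have [ez|en] := eqVneq e 0.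
    move/eqP: esq; rewrite ez expr0n eq_sym paddr_eq0 ?sqr_ge0 // !sqrf_eq0.
    rewrite !subr_eq0 => /andP[/eqP -> /eqP ->].
    by exists (1, 0); split; rewrite /dotp /= ?subrr ?mul0r //; ring.
  exists ((x.1 - c.1) / e, (x.2 - c.2) / e).
  split=> /=; [|by rewrite mulrC divfK..].
  rewrite /dotp /= !mulf_div -mulrDl; apply: canLR (mulfK _) _.
    by rewrite mulf_neq0.
  by rewrite mul1r -(expr2 e) esq; ring.
have /sub : cdisk x r (x + (r * u.1, r * u.2)).
  rewrite /cdisk /= edist_le // /sqdist.
  suff -> : dotp (x - (x + (r * u.1, r * u.2))) (x - (x + (r * u.1, r * u.2))) =
     r ^+ 2 * dotp u u by rewrite u1 mulr1.
  by rewrite /dotp /=; ring.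
apply: le_trans; rewrite edist_sqdist.
have -> : sqdist c (x + (r * u.1, r * u.2)) = (e + r) ^+ 2 * dotp u u.
  have -> : (e + r) ^+ 2 * dotp u u =
    (e * u.1 + r * u.1) ^+ 2 + (e * u.2 + r * u.2) ^+ 2 by rewrite /dotp; ring.
  by rewrite -eu1 -eu2 /sqdist /dotp /=; ring.
by rewrite u1 mulr1 sqrtr_sqr ger0_norm // addr_ge0.
Qed.

Lemma cdisk_subset_inter (cs : seq (plane R)) x r : 0 <= r ->
  cdisk x r `<=` unit_disk_inter cs <->
  forall c, c \in cs -> edist c x <= 1 - r.
Proof.
move=> r0; rewrite /unit_disk_inter; split=> [sub c ccs|le y xy c /= ccs].
  by rewrite lerBrDr; apply/(cdisk_subset _ _ _ r0) => y /sub; apply.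
have /(cdisk_subset _ _ _ r0) : edist c x + r <= 1 by rewrite -lerBrDr; exact: le.
by apply.
Qed.

End Jung.

(** * Comparison of the two inradii *)

Theorem lemma1p8 (R : realType) (d : R) (hd1 : 1 <= d) (hd3 : d < Num.sqrt 3)
    (D : set (plane R)) (hD : center_param_family d D)
    (Delta : set (plane R)) (hDelta : is_regular_disk_triangle d Delta) :
  inradius Delta <= inradius D.
Proof.
have s3 : 0 < Num.sqrt 3 :> R by rewrite sqrtr_gt0.
have d0 : 0 <= d by apply: le_trans hd1.
have rho0 : 0 <= d / Num.sqrt 3 by rewrite divr_ge0 // ltW.
have rho1 : d / Num.sqrt 3 < 1 by rewrite ltr_pdivrMr // mul1r.
(* [r0] separates the inradii: Jung's theorem puts it below that of [D], the centroid bound above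
   that of [Delta]. It is positive because [d < Num.sqrt 3]. *)
pose r0 := 1 - d / Num.sqrt 3.
have r0pos : 0 < r0 by rewrite subr_gt0.
have le_r0 : r0 <= inradius D.
  have [cs [cs0 _ -> _ _] hd] := hD.
  have [x hx] := jung d0 hd.
  apply: ub_le_sup.
    (* A disk inside a unit disk has radius at most 1, so the supremum is over a bounded set. *)
    exists 1 => r [rpos [y /(cdisk_subset_inter _ _ (ltW rpos)) hy]].
    case: cs cs0 hy {hd hx} => // c cs _ /(_ c (mem_head _ _)).
    by have := edist_ge0 c y; lra.
  split=> //; exists x; apply/cdisk_subset_inter; first exact: ltW.
  by move=> c /hx cx; rewrite subKr.
apply: le_trans le_r0.
(* The supremum of the empty set is 0 by convention, which is below [r0]. *)
rewrite /inradius; have [-> |ne] := eqVneq (disk_radii Delta) set0.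
  by rewrite sup0 ltW.
apply: ge_sup; first exact/set0P.
have [p1 [p2 [p3 [h12 h23 h31 ->]]]] := hDelta.
move=> r [rpos [x /(cdisk_subset_inter _ _ (ltW rpos)) hx]].
have h c : c \in [:: p1; p2; p3] -> sqdist c x <= (1 - r) ^+ 2.
  by move=> /hx ?; rewrite -edist_le //; apply: le_trans (edist_ge0 c x) _.
have r1 : 0 <= 1 - r by apply: le_trans (edist_ge0 p1 x) (hx _ (mem_head _ _)).
(* The three squared distances are each at most [(1 - r) ^+ 2] and add up to at least [d ^+ 2]. *)
have := @sqdist_sum_equilateral_ge R p1 p2 p3 x (d ^+ 2).
rewrite -!sqr_edist h12 h23 h31 !sqr_edist => /(_ erefl erefl erefl) sum.
have h1 := h p1; have h2 := h p2; have h3 := h p3.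
move: h1 h2 h3; rewrite !inE !eqxx !orbT => /(_ isT) h1 /(_ isT) h2 /(_ isT) h3.
rewrite /r0 lerBrDl -lerBrDr.
rewrite -ler_sqr ?nnegrE // expr_div_n sqr_sqrtr // ler_pdivrMr //; lra.
Qed.
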